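(* Let $e\ge1$ be a positive integer and let $g\in B_3$ be the $e$th power of a positive half-twist. Then the Garside normal form of $g$ is $$g=\Delta^{-\omega(\tau)}\rho\,\sigma_i^{e}\,\tau,$$ where $\rho,\tau\in B_3^{+}$ are positive braids such that $\rho$ is dual to $\tau$, and $i\in\{1,2\}$. (In particular $\rho\sigma_i^e\tau$ is indivisible by $\Delta$.)
   Context: $B_3=\langle\sigma_1,\sigma_2:\sigma_1\sigma_2\sigma_1=\sigma_2\sigma_1\sigma_2\rangle$ is the braid group on three strands, $\Delta=\sigma_1\sigma_2\sigma_1$ is the Garside element, and $B_3^{+}$ is the submonoid of positive braids generated by $\sigma_1,\sigma_2$. A positive braid $\sigma$ is divisible by $\Delta$ if $\sigma=\Delta\tau$ for some $\tau\in B_3^+$, and indivisible by $\Delta$ otherwise. Every $g\in B_3$ can be written uniquely as $g=\Delta^k\sigma$ with $k\in\mathbb{Z}$ and $\sigma\in B_3^+$ indivisible by $\Delta$; this is the Garside normal form of $g$, and $k$ is its Garside power. A positive half-twist is a conjugate of $\sigma_1$ in $B_3$; the set of $e$th powers of positive half-twists is the conjugacy class of $\sigma_1^e$. For positive braids $\rho,\tau\in B_3^+$ indivisible by $\Delta$, $\rho$ is dual to $\tau$ if $\rho\tau$ is a nonnegative power of $\Delta$; equivalently $\tau^{-1}=\Delta^{-\omega(\tau)}\rho$ is the Garside normal form of $\tau^{-1}$, where $\omega(\tau)\ge0$ is an integer determined by $\tau$, so that $\rho\tau=\Delta^{\omega(\tau)}$. *)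

(* Defs.v *)
From HB Require Import structures.
From mathcomp Require Import all_boot all_order all_algebra.
From mathcomp Require Import generic_quotient.
From mathcomp Require Import boolp classical_sets.

Set Implicit Arguments.
Unset Strict Implicit.
Unset Printing Implicit Defensive.

Local Open Scope quotient_scope.
Local Open Scope group_scope.

(** [(i, false)] stands for sigma_(i+1) and [(i, true)] for its inverse. *)
Definition letter : Type := 'I_2 * bool.
Definition word : Type := seq letter.

Definition inv_letter (a : letter) : letter := (a.1, ~~ a.2).
Definition gen (i : 'I_2) : letter := (i, false).

(** The congruence on words generated by free cancellation and by
    sigma_1 sigma_2 sigma_1 = sigma_2 sigma_1 sigma_2. *)
Inductive braid_eq : word -> word -> Prop :=
| braid_refl u : braid_eq u u
| braid_sym u v : braid_eq u v -> braid_eq v u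
| braid_trans u v w : braid_eq u v -> braid_eq v w -> braid_eq u w
| braid_cat u u' v v' :
    braid_eq u u' -> braid_eq v v' -> braid_eq (u ++ v) (u' ++ v')
| braid_cancel a : braid_eq [:: a; inv_letter a] [::]
| braid_rel : braid_eq [:: gen ord0; gen ord_max; gen ord0]
                       [:: gen ord_max; gen ord0; gen ord_max].

Definition braid_eqb : rel word := fun u v => `[< braid_eq u v >].

Lemma braid_eqb_refl : reflexive braid_eqb.
Proof. by move=> u; apply/asboolP; apply: braid_refl. Qed.

Lemma braid_eqb_sym : symmetric braid_eqb.
Proof.
by move=> u v; apply/idP/idP=> /asboolP H; apply/asboolP; apply: braid_sym.
Qed.

Lemma braid_eqb_trans : transitive braid_eqb.
Proof.
move=> v u w /asboolP uv /asboolP vw; apply/asboolP.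
exact: braid_trans uv vw.
Qed.

Definition braid_equiv : equiv_rel word :=
  EquivRel braid_eqb braid_eqb_refl braid_eqb_sym braid_eqb_trans.

Definition B3 : Type := {eq_quot braid_equiv}.
HB.instance Definition _ := Choice.on B3.
HB.instance Definition _ := Quotient.on B3.

Definition braid_of (w : word) : B3 := \pi_B3 w.

Lemma braid_ofP u v : braid_of u = braid_of v <-> braid_eq u v.
Proof.
split=> [/eqmodP/asboolP // | uv].
by apply/eqmodP/asboolP.
Qed.

Lemma braid_ofK (x : B3) : braid_of (repr x) = x.
Proof. exact: reprK. Qed.

Definition inv_word (w : word) : word := rev (map inv_letter w).

Lemma inv_letterK : involutive inv_letter.
Proof. by case=> i b; rewrite /inv_letter negbK. Qed.

Lemma inv_word_cat u v : inv_word (u ++ v) = inv_word v ++ inv_word u.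
Proof. by rewrite /inv_word map_cat rev_cat. Qed.

Lemma inv_wordK : involutive inv_word.
Proof.
by move=> w; rewrite /inv_word map_rev revK mapK //; apply: inv_letterK.
Qed.

Lemma braid_eq_inv u v : braid_eq u v -> braid_eq (inv_word u) (inv_word v).
Proof.
have cancelVr (w : word) : braid_eq (w ++ inv_word w) [::].
  elim: w => [|a w IHw]; first exact: braid_refl.
  rewrite -[a :: w]cat1s inv_word_cat -catA [w ++ _]catA.
  apply: braid_trans (braid_cancel a).
  apply: (@braid_cat [:: a] [:: a]); first exact: braid_refl.
  exact: (braid_cat IHw (braid_refl _)).
have cancelVl (w : word) : braid_eq (inv_word w ++ w) [::].
  by rewrite -{2}[w]inv_wordK.
move=> uv; apply: (@braid_trans _ (inv_word u ++ (v ++ inv_word v))).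
  rewrite -{1}[inv_word u]cats0; apply: braid_cat; first exact: braid_refl.
  by apply: braid_sym.
rewrite catA -{2}[inv_word v]cat0s; apply: braid_cat; last exact: braid_refl.
apply: braid_trans (cancelVl u); apply: braid_cat; first exact: braid_refl.
by apply: braid_sym.
Qed.

Lemma braid_eq_invl w : braid_eq (inv_word w ++ w) [::].
Proof.
elim: w => [|a w IHw]; first exact: braid_refl.
rewrite -[a :: w]cat1s inv_word_cat -catA [inv_word [:: a] ++ _]catA.
apply: braid_trans IHw; apply: braid_cat; first exact: braid_refl.
rewrite -{2}[w]cat0s; apply: braid_cat; last exact: braid_refl.
by have := braid_cancel (inv_letter a); rewrite inv_letterK.
Qed.

Definition braid_mul (x y : B3) : B3 := braid_of (repr x ++ repr y).
Definition braid_one : B3 := braid_of [::].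
Definition braid_inv (x : B3) : B3 := braid_of (inv_word (repr x)).

Lemma repr_braid_of w : braid_eq (repr (braid_of w)) w.
Proof. by apply/braid_ofP; rewrite braid_ofK. Qed.

Lemma braid_mulE u v : braid_mul (braid_of u) (braid_of v) = braid_of (u ++ v).
Proof. by apply/braid_ofP; apply: braid_cat; apply: repr_braid_of. Qed.

Lemma braid_invE w : braid_inv (braid_of w) = braid_of (inv_word w).
Proof. by apply/braid_ofP; apply: braid_eq_inv; apply: repr_braid_of. Qed.

Lemma braid_mulA : associative braid_mul.
Proof.
move=> x y z; rewrite -[x]braid_ofK -[y]braid_ofK -[z]braid_ofK.
by rewrite !braid_mulE catA.
Qed.

Lemma braid_mul1 : left_id braid_one braid_mul.
Proof. by move=> x; rewrite -[x]braid_ofK braid_mulE. Qed.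

Lemma braid_mulr1 : right_id braid_one braid_mul.
Proof. by move=> x; rewrite -[x]braid_ofK braid_mulE cats0. Qed.

Lemma braid_mulV : left_inverse braid_one braid_inv braid_mul.
Proof.
move=> x; rewrite -[x]braid_ofK braid_invE braid_mulE.
by apply/braid_ofP; apply: braid_eq_invl.
Qed.

Lemma braid_mulrV : right_inverse braid_one braid_inv braid_mul.
Proof.
move=> x; rewrite -[x]braid_ofK braid_invE braid_mulE.
apply/braid_ofP; rewrite -{1}[repr x]inv_wordK; exact: braid_eq_invl.
Qed.

HB.instance Definition _ := isGroup.Build B3
  braid_mulA braid_mul1 braid_mulr1 braid_mulV braid_mulrV.

(** With ['I_2] = {0, 1}, [sigma i] is the standard generator sigma_(i+1). *)
Definition sigma (i : 'I_2) : B3 := braid_of [:: gen i].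
Definition sigma1 : B3 := sigma ord0.
Definition sigma2 : B3 := sigma ord_max.

Lemma sigma_braid : sigma1 * sigma2 * sigma1 = sigma2 * sigma1 * sigma2.
Proof.
have mulE u v : braid_of u * braid_of v = braid_of (u ++ v) := braid_mulE u v.
by rewrite /sigma1 /sigma2 /sigma !mulE; apply/braid_ofP; apply: braid_rel.
Qed.

Definition Delta : B3 := sigma1 * sigma2 * sigma1.

Definition zexpg (G : groupType) (x : G) (k : int) : G :=
  match k with Posz n => x ^+ n | Negz n => x ^- n.+1 end.

Definition positive (x : B3) : Prop :=
  exists s : seq 'I_2, x = \prod_(i <- s) sigma i.

Definition Delta_divides (x : B3) : Prop :=
  exists2 y, positive y & x = Delta * y.

Definition indivisible (x : B3) : Prop := ~ Delta_divides x.

Definition garside_normal_form (g : B3) (k : int) (x : B3) : Prop :=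
  [/\ positive x, indivisible x & g = zexpg Delta k * x].

(** By [garside_normal_form_uniq] below, at most one [k] is eligible; the
    default value [0] is only taken if there is none. *)
Definition garside_power (g : B3) : int :=
  xget 0%R [set k | exists x, garside_normal_form g k x].

Definition half_twist (h : B3) : Prop := exists x : B3, h = sigma1 ^ x.

Definition half_twist_power (e : nat) (g : B3) : Prop :=
  exists2 h, half_twist h & g = h ^+ e.

Definition dual (rho tau : B3) : Prop :=
  [/\ positive rho, indivisible rho, positive tau, indivisible tau
    & exists n : nat, rho * tau = Delta ^+ n].

(** The Garside normal form of the inverse of [tau] is
    Delta^(- omega tau) * rho; see also [dual_omega]. *)
Definition omega (tau : B3) : int := (- garside_power (tau^-1)%g)%R.

Lemma zexpgDn (G : groupType) (x : G) (k : int) (n : nat) :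
  zexpg x (k + n%:Z)%R = zexpg x k * x ^+ n.
Proof.
case: k => m; first exact: expgnDr.
have [le_nm | lt_mn] := leqP n m.
  have -> : (Negz m + n%:Z)%R = (- (m.+1 - n)%N%:Z)%R.
    by rewrite NegzE -subzn ?leqW // GRing.opprB GRing.addrC.
  rewrite subSn //= -subSn // (expgnFr x (leqW le_nm)) invgM invgK.
  by apply/commuteV/commuteX2.
have -> : (Negz m + n%:Z)%R = Posz (n - m.+1).
  by rewrite NegzE -subzn // GRing.addrC.
by rewrite /= -[in RHS](subnKC lt_mn) expgnDr mulKg.
Qed.

Lemma positiveM x y : positive x -> positive y -> positive (x * y).
Proof. by move=> [s ->] [t ->]; exists (s ++ t); rewrite big_cat. Qed.

Lemma positive_Delta n : positive (Delta ^+ n).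
Proof.
elim: n => [|n IHn]; first by exists [::]; rewrite big_nil.
rewrite expgS; apply: positiveM IHn.
exists [:: ord0; ord_max; ord0].
by rewrite !big_cons big_nil mulg1 mulgA.
Qed.

Lemma garside_normal_form_uniq g k l x y :
  garside_normal_form g k x -> garside_normal_form g l y -> k = l /\ x = y.
Proof.
have lt_contra k' l' x' y' : garside_normal_form g k' x' ->
    garside_normal_form g l' y' -> (k' < l')%R -> False.
  move=> [px ix gx] [py iy gy] lt_kl.
  have [n def_l] : exists n : nat, l' = (k' + n.+1%:Z)%R.
    have : (0 < l' - k')%R by rewrite Num.Theory.subr_gt0.
    case def_d: (l' - k')%R => [[|n]|n] // _.
    by exists n; rewrite -def_d GRing.addrC GRing.subrK.
  apply: ix; exists (Delta ^+ n * y'); first exact: positiveM (positive_Delta n) py.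
  apply: (@mulgI _ (zexpg Delta k')).
  by rewrite -gx gy def_l zexpgDn expgS !mulgA.
move=> nx ny; have eq_kl : k = l.
  case: (Order.TotalTheory.ltgtP k l) => // lt_kl.
    by case: (lt_contra _ _ _ _ nx ny lt_kl).
  by case: (lt_contra _ _ _ _ ny nx lt_kl).
split=> //; case: nx ny => _ _ gx [_ _ gy].
by apply: (@mulgI _ (zexpg Delta k)); rewrite -gx {1}gy eq_kl.
Qed.

Lemma dual_omega rho tau : dual rho tau ->
  rho * tau = zexpg Delta (omega tau)
  /\ garside_normal_form tau^-1 (- omega tau)%R rho.
Proof.
move=> [prho irho ptau itau [n rt]].
have nf : garside_normal_form tau^-1 (- n%:Z)%R rho.
  split=> //.
  have -> : zexpg Delta (- n%:Z)%R = Delta ^- n by case: n {rt} => [|n] //=; rewrite invg1.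
  by rewrite -rt invgM mulgVK.
have gp : garside_power tau^-1 = (- n%:Z)%R.
  rewrite /garside_power; case: xgetP => [k _ [x nx] | none].
    by case: (garside_normal_form_uniq nx nf).
  by case: (none (- n%:Z)%R); exists rho.
by rewrite /omega gp GRing.opprK.
Qed.

(* Main.v *)
Require Import Defs.
From mathcomp Require Import all_boot all_order all_algebra.

Set Implicit Arguments.
Unset Strict Implicit.

Local Open Scope group_scope.

(** A word in the two generators is called reduced when it has no factor [aba]
    with [a != b], that is, when no braid relation applies to it. The reduced
    words are the positive braids indivisible by Delta, each written in its
    unique way. One half of this, that a reduced word is indivisible in the
    whole group ([reduced_indivisible]), is the uniqueness part of Garside's
    theorem; it turns the claim into one about words. It is obtained by letting
    the group act on pairs of a reduced word [w] and an integer [k], thought of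
    as [w * Delta ^ k]: a generator is put in front of [w], and a factor [aba]
    that appears there is removed as a Delta, which moves to the right end and
    exchanges the two generators on its way. This respects the braid relation
    ([push_Delta], [act_braid_eq]), so the image [nf x] of the empty word
    depends on the braid [x] only, and reading it back gives the existence of
    Garside normal forms ([garside_form]).

    Now let [g] be conjugate to the [e]th power of a generator. The conjugating
    braid is a power of Delta, which only exchanges the generators, times a
    reduced word. Choose the conjugator [tau] as short as possible, letting the
    generator [a] that it conjugates vary. Then [tau] begins neither with [a],
    which commutes with [a], nor with [ba], which conjugates [a] to [b]
    ([twist_free_conj]); so [tau] is empty, or [b], or begins with [bb].
    Let [rho] be dual to [tau]. If [tau] is not empty, the word of
    [rho * tau], a power of Delta, is not reduced, so a factor [bab] or [aba]
    straddles the junction; by the shape of [tau] this forces [rho] to end in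
    [ba]. Inserting [e >= 1] letters [a] between [ba] and [b..] destroys
    that factor and creates none ([dual_splice]), so the word of
    [rho * a ^ e * tau] is reduced, hence indivisible by Delta. *)

(** * Positive words and the Garside element *)

Lemma rev_ord2_neq (i : 'I_2) : rev_ord i != i.
Proof. by case: i => [[|[|]]]. Qed.

Lemma neq_ord2 (i j : 'I_2) : i != j -> i = rev_ord j.
Proof.
by move=> neq; apply: val_inj; case: i j neq => [[|[|]] // ?] [[|[|]] // ?].
Qed.

Definition pos (w : seq 'I_2) : B3 := \prod_(i <- w) sigma i.

Lemma pos_cons i w : pos (i :: w) = sigma i * pos w.
Proof. by rewrite /pos big_cons. Qed.

Lemma pos_cat u v : pos (u ++ v) = pos u * pos v.
Proof. by rewrite /pos big_cat. Qed.

Lemma pos_nseq n i : pos (nseq n i) = sigma i ^+ n.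
Proof. by elim: n => [|n IHn]; rewrite ?expgS -?IHn /pos ?big_nil ?big_cons. Qed.

Lemma positive_pos w : positive (pos w).
Proof. by exists w. Qed.

Lemma braid_of_cat u v : braid_of (u ++ v) = braid_of u * braid_of v.
Proof. by rewrite -braid_mulE. Qed.

Lemma braid_of_gens w : braid_of (map gen w) = pos w.
Proof.
elim: w => [|i w IHw]; first by rewrite /pos big_nil.
by rewrite pos_cons -IHw -braid_of_cat.
Qed.

(** The braid relation makes Delta symmetric in the two generators, so later
    arguments need not distinguish them. *)
Lemma DeltaE i : Delta = sigma i * sigma (rev_ord i) * sigma i.
Proof.
have [->|/neq_ord2 ->] := eqVneq i ord0.
  by rewrite (_ : rev_ord ord0 = ord_max); last exact: val_inj.
rewrite (_ : rev_ord (rev_ord _) = ord0); last exact: val_inj.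
by rewrite (_ : rev_ord ord0 = ord_max) ?[Delta]sigma_braid //; apply: val_inj.
Qed.

Lemma sigma_Delta i : sigma i * Delta = Delta * sigma (rev_ord i).
Proof. by rewrite {2}(DeltaE i) (DeltaE (rev_ord i)) rev_ordK !mulgA. Qed.

(** The renaming [f] is the identity or the exchange of the generators, by the
    parity of [k]; being injective, it keeps reduced words reduced. *)
Lemma sigma_conj_zexpg_Delta k : exists2 f : 'I_2 -> 'I_2,
  injective f & forall i, sigma i ^ zexpg Delta k = sigma (f i).
Proof.
have conjD i : sigma i ^ Delta = sigma (rev_ord i).
  by rewrite conjgE sigma_Delta mulKg.
have conjDX n : exists2 f : 'I_2 -> 'I_2,
    injective f & forall i, sigma i ^ (Delta ^+ n) = sigma (f i).
  elim: n => [|n [f f_inj fE]]; first by exists id => // i; rewrite conjg1.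
  exists (@rev_ord 2 \o f); first exact: inj_comp rev_ord_inj f_inj.
  by move=> i; rewrite expgSr conjgM fE conjD.
case: k => n; first exact: conjDX.
have [f f_inj fE] := conjDX n.+1.
exists (invF f_inj); first exact: (can_inj (f_invF f_inj)).
by move=> i; apply: (canLR (conjgK _)); rewrite fE f_invF.
Qed.

(** * Reduced words *)

Fixpoint reduced (w : seq 'I_2) : bool :=
  if w is a :: w' then
    reduced w' && (if w' is b :: c :: _ then (a == b) || (c != a) else true)
  else true.

Lemma reduced_cons a w : reduced (a :: w) =
  reduced w && (if w is b :: c :: _ then (a == b) || (c != a) else true).
Proof. by []. Qed.

Lemma reduced_tl a w : reduced (a :: w) -> reduced w.
Proof. by case/andP. Qed.

Lemma reduced_map (f : 'I_2 -> 'I_2) w :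
  injective f -> reduced (map f w) = reduced w.
Proof.
move=> f_inj; elim: w => [|a w IHw] //=; rewrite IHw.
by case: w {IHw} => [|b [|c w]] //=; rewrite !(inj_eq f_inj).
Qed.

(** A forbidden factor has three letters, so it cannot cross an overlap of two
    letters without lying in one of the two parts. *)
Lemma reduced_glue u a b v :
  reduced (u ++ a :: b :: v) = reduced (u ++ [:: a; b]) && reduced (a :: b :: v).
Proof.
elim: u => [|x u IHu] //.
rewrite !cat_cons /= {}IHu.
by case: u => [|y [|z u]] //=; rewrite ?andbT -?andbA; do !bool_congr.
Qed.

(** * The action of the braid group on normal forms *)

(** The pair [(w, k)] stands for the braid [pos w * Delta ^ k]. Powers of
    Delta are kept on the right because generators act on the left. *)
Definition state : Type := (seq 'I_2 * int)%type.
Definition flip : seq 'I_2 -> seq 'I_2 := map (@rev_ord 2).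

Lemma flipK : involutive flip.
Proof. by apply: mapK; apply: rev_ordK. Qed.

Lemma flip_cons a w : flip (a :: w) = rev_ord a :: flip w.
Proof. by []. Qed.

Lemma reduced_flip w : reduced (flip w) = reduced w.
Proof. exact: reduced_map rev_ord_inj. Qed.

(** Left multiplication by [Delta ^ z] for odd [z]; it is used for 1 and -1. *)
Definition shift (z : int) (s : state) : state := (flip s.1, (s.2 + z)%R).

(** Left multiplication by [sigma i], where [i a i v] is rewritten as
    [Delta v], that is, as [flip v] followed by Delta. *)
Definition push (i : 'I_2) (s : state) : state :=
  match s.1 with
  | a :: b :: v => if (a != i) && (b == i) then (flip v, (s.2 + 1)%R)
                   else (i :: s.1, s.2)
  | _ => (i :: s.1, s.2)
  end.

(** The inverse of [sigma i] acts as
    [Delta ^ -1 * sigma i * sigma (rev_ord i)]. *)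
Definition act (a : letter) (s : state) : state :=
  if a.2 then shift (-1)%R (push a.1 (push (rev_ord a.1) s)) else push a.1 s.

Definition act_word (u : word) (s : state) : state := foldr act s u.

Definition value (s : state) : B3 := pos s.1 * zexpg Delta s.2.

Lemma push_reduced i s : reduced s.1 -> reduced (push i s).1.
Proof.
case: s => [[|a [|b v]] k] //= red; rewrite /push /=.
case: ifP => /= [_|].
  by rewrite reduced_flip; case/andP: red => /andP[].
move: red => /= -> /=; rewrite eq_sym.
by case: eqP => //= _ ->.
Qed.

Lemma push_nf i w k : reduced (i :: w) -> push i (w, k) = (i :: w, k).
Proof.
case: w => [|a [|b v]] //= /andP[_]; rewrite /push /= [i == a]eq_sym.
by case: eqP => //= _ /negPf ->.
Qed.

Lemma shift_reduced z s : reduced s.1 -> reduced (shift z s).1.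
Proof. by rewrite /= reduced_flip. Qed.

Lemma push_shift z i s : push i (shift z s) = shift z (push (rev_ord i) s).
Proof.
case: s => [[|a [|b v]] k] //=; rewrite /push /shift /= ?rev_ordK //.
rewrite !(canF_eq (@rev_ordK 2)).
by case: ifP => _ //=; rewrite ?rev_ordK // GRing.addrAC.
Qed.

Lemma push_pop i v k : push i (rev_ord i :: i :: v, k) = (flip v, (k + 1)%R).
Proof. by rewrite /push /= rev_ord2_neq eqxx. Qed.

Lemma not_reduced_cons i w : reduced w -> ~~ reduced (i :: w) ->
  exists v, w = rev_ord i :: i :: v.
Proof.
case: w => [|a [|b v]] red //; rewrite reduced_cons red negb_or negbK eq_sym.
by case/andP=> /neq_ord2-> /eqP->; exists v.
Qed.

(** The heart of the construction: the three pushes act as Delta, whichever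
    generator comes first, because exactly one of them removes a factor. It is
    the first one if [w] begins with [j i] (where [j] is the other generator),
    the second if [w] begins with [j] otherwise, and the third in the remaining
    cases. Reducedness of [w] is what prevents a second removal. *)
Lemma push_Delta i s :
  reduced s.1 -> push i (push (rev_ord i) (push i s)) = shift 1 s.
Proof.
case: s => w k /= red; rewrite /shift /=.
have [red_iw|/not_reduced_cons[//|v def_w]] := boolP (reduced (i :: w)); last first.
  rewrite def_w push_pop -reduced_flip !flip_cons rev_ordK in red *.
  by rewrite !push_nf //; apply: reduced_tl red.
rewrite push_nf //; case: w => [|a v] in red red_iw *.
  by rewrite push_nf // push_pop.
have [def_a|/neq_ord2 def_a] := eqVneq a i.
  rewrite push_nf ?push_pop // reduced_cons red_iw def_a.
  by rewrite [i == rev_ord i]eq_sym rev_ord2_neq orbT.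
have := push_pop (rev_ord i) v k; rewrite rev_ordK => pop.
rewrite def_a pop flip_cons rev_ordK push_nf //.
by rewrite def_a -reduced_flip flip_cons rev_ordK in red.
Qed.

Lemma act_reduced a s : reduced s.1 -> reduced (act a s).1.
Proof.
rewrite /act; case: a.2 => red; last exact: push_reduced.
by apply: shift_reduced; do 2!apply: push_reduced.
Qed.

Lemma act_word_reduced u s : reduced s.1 -> reduced (act_word u s).1.
Proof. by elim: u => //= a u IHu red; apply/act_reduced/IHu. Qed.

Lemma shiftK z : cancel (shift z) (shift (- z)%R).
Proof. by case=> w k; rewrite /shift /= flipK GRing.addrK. Qed.

(** Cancellation and the braid relation both reduce to [push_Delta]. *)
Lemma act_braid_eq u v : braid_eq u v ->
  forall s, reduced s.1 -> act_word u s = act_word v s.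
Proof.
elim=> {u v}
  [u|u v _ IH|u v w _ IHuv _ IHvw|u u' v v' _ IHu _ IHv|[i b]|] s red //.
- by rewrite IH.
- by rewrite IHuv // IHvw.
- rewrite /act_word !foldr_cat -/(act_word v s) IHv //.
  by apply: IHu; apply: act_word_reduced.
- case: b; rewrite /= /act /inv_letter /=.
    by rewrite push_Delta // shiftK.
  have := push_Delta (rev_ord i) red; rewrite rev_ordK => def_s.
  by rewrite push_shift def_s shiftK.
have := push_Delta ord0 red; have := push_Delta ord_max red.
rewrite (_ : rev_ord ord0 = ord_max); last exact: val_inj.
rewrite (_ : rev_ord ord_max = ord0); last exact: val_inj.
by rewrite /= /act /= => -> ->.
Qed.

Definition nf (x : B3) : state := act_word (repr x) ([::], 0%R).

Lemma nf_braid_of u : nf (braid_of u) = act_word u ([::], 0%R).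
Proof. exact: act_braid_eq (repr_braid_of u) _ _. Qed.

Lemma nf_reduced x : reduced (nf x).1.
Proof. exact: act_word_reduced. Qed.

Lemma nf_sigma i x : nf (sigma i * x) = push i (nf x).
Proof. by rewrite -[x]braid_ofK -braid_of_cat !nf_braid_of. Qed.

Lemma nf_Delta x : nf (Delta * x) = shift 1 (nf x).
Proof.
by rewrite (DeltaE ord0) -!mulgA !nf_sigma push_Delta ?nf_reduced.
Qed.

Lemma nf_DeltaX n : nf (Delta ^+ n) = ([::], n%:Z)%R.
Proof.
elim: n => [|n IHn]; first exact: (nf_braid_of [::]).
by rewrite expgS nf_Delta IHn /shift /= -PoszD addn1.
Qed.

Lemma nf_pos w : reduced w -> nf (pos w) = (w, 0%R).
Proof.
elim: w => [|i w IHw] red; first by rewrite -braid_of_gens nf_braid_of.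
by rewrite pos_cons nf_sigma IHw ?push_nf //; apply: reduced_tl red.
Qed.

(** Pushing a generator never lowers the exponent of Delta. *)
Lemma nf_positive x : positive x -> (0 <= (nf x).2)%R.
Proof.
case=> w ->; rewrite -/(pos w).
elim: w => [|i w IHw]; first by rewrite -braid_of_gens nf_braid_of.
rewrite pos_cons nf_sigma; case: (nf (pos w)) IHw => v k /= k_ge0.
rewrite /push /=; case: v => [|a [|b v]] //=.
by case: ifP => //= _; apply: Num.Theory.addr_ge0.
Qed.

(** Dividing by Delta would leave a positive braid with exponent -1. *)
Lemma reduced_indivisible w : reduced w -> indivisible (pos w).
Proof.
move=> red [y y_pos def_w].
have := nf_positive y_pos; have := nf_pos red.
rewrite def_w nf_Delta => -[_ /eqP]; rewrite GRing.addr_eq0 => /eqP->.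
by [].
Qed.

Lemma reduced_DeltaX w n : reduced w -> pos w = Delta ^+ n -> w = [::].
Proof. by move=> red def_w; have := nf_pos red; rewrite def_w nf_DeltaX; case. Qed.

(** * Existence of normal forms *)

Lemma value_shift1 s : value (shift 1 s) = Delta * value s.
Proof.
have flipD v : pos (flip v) * Delta = Delta * pos v.
  elim: v => [|a v IHv]; first by rewrite /pos !big_nil mul1g mulg1.
  by rewrite flip_cons !pos_cons -mulgA IHv mulgA sigma_Delta rev_ordK mulgA.
case: s => w k; rewrite /value /shift /=.
have -> : zexpg Delta (k + 1)%R = zexpg Delta k * Delta := zexpgDn Delta k 1.
have -> : zexpg Delta k * Delta = Delta * zexpg Delta k.
  by case: k => n; [apply/commute_sym/commuteX | apply/commute_sym/commuteV/commuteX].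
by rewrite mulgA flipD mulgA.
Qed.

Lemma value_push i s : value (push i s) = sigma i * value s.
Proof.
case: s => w k; have [[v ->]|push_w] : (exists v, w = rev_ord i :: i :: v)
    \/ push i (w, k) = (i :: w, k).
- case: w => [|a [|b v]]; [by right | by right | rewrite /push /=].
  by case: ifP => [/andP[/neq_ord2-> /eqP->]|_]; [left; exists v | right].
- rewrite push_pop (value_shift1 (v, k)) /value /= !pos_cons.
  by rewrite (DeltaE i) !mulgA.
by rewrite push_w /value /= pos_cons mulgA.
Qed.

(** The case of an inverse letter is checked after multiplying by Delta, which
    turns it into two pushes. *)
Lemma value_act a s : value (act a s) = braid_of [:: a] * value s.
Proof.
case: a => i [] /=; last exact: value_push.
have def_s : shift 1 (act (i, true) s) = push i (push (rev_ord i) s).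
  by have := shiftK (- 1)%R (push i (push (rev_ord i) s)); rewrite GRing.opprK.
apply: (@mulgI _ Delta); rewrite -value_shift1 def_s !value_push.
have sigmaV : sigma i * braid_of [:: (i, true)] = 1.
  by rewrite -[RHS](braid_mulrV (sigma i)) braid_invE.
by rewrite -[in LHS](mul1g (value s)) -sigmaV (DeltaE i) -!mulgA.
Qed.

Lemma value_nf x : value (nf x) = x.
Proof.
rewrite -[RHS]braid_ofK /nf; elim: (repr x) => [|a u IHu] /=.
  by rewrite /value /pos big_nil mul1g.
by rewrite value_act IHu -braid_of_cat.
Qed.

(** The action produces Delta on the right; conjugating the word by the power
    of Delta moves it to the left. *)
Lemma garside_form x :
  exists k w, reduced w /\ x = zexpg Delta k * pos w.
Proof.
have := value_nf x; rewrite /value; have := nf_reduced x.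
case: (nf x) => w k /= red <-.
have [f f_inj fE] := sigma_conj_zexpg_Delta k.
exists k, (map f w); rewrite reduced_map //; split=> //.
rewrite [LHS]conjgC /pos conjg_prod big_map; congr (_ * _).
by apply: eq_bigr => i _; rewrite fE.
Qed.

(** * Conjugates of powers of a generator *)

(** What remains of a conjugator of [sigma i] once it can no longer be shortened
    from the left: [t] begins neither with [i] nor with [a i] for the other
    generator [a]. *)
Definition twist_free (i : 'I_2) (t : seq 'I_2) : bool :=
  if t is a :: t' then (a != i) && (if t' is b :: _ then b == a else true)
  else true.

Lemma conj_sigma_step i : sigma i ^ (sigma (rev_ord i) * sigma i) = sigma (rev_ord i).
Proof.
apply: (@mulgI _ (sigma (rev_ord i) * sigma i)); rewrite -conjgC mulgA -DeltaE.
by rewrite (DeltaE (rev_ord i)) rev_ordK.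
Qed.

(** A first letter [i] commutes with [sigma i] and is dropped; two first letters
    [a i] conjugate [sigma i] to [sigma a] and are dropped as well. *)
Lemma twist_free_conj i w : reduced w ->
  exists j t, [/\ reduced t, twist_free j t & sigma i ^ pos w = sigma j ^ pos t].
Proof.
have [n] := ubnP (size w); elim: n => // n IHn in i w *.
case: w => [|a w] /=; first by exists i, [::].
rewrite ltnS => lt_w red; have [->|/[dup] ai /neq_ord2 def_a] := eqVneq a i.
  have [|j [t [red_t free_t conj_t]]] := IHn i w lt_w.
    exact: reduced_tl red.
  exists j, t; split=> //.
  by rewrite -conj_t pos_cons conjgM [sigma i ^ sigma i]mulKg.
case: w => [|b w] in lt_w red *; first by exists i, [:: a]; rewrite /= ai.
have [ba|/neq_ord2 def_b] := eqVneq b a.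
  by exists i, (a :: b :: w); split; rewrite // /twist_free ai ba eqxx.
have [||j [t [red_t free_t conj_t]]] := IHn a w; first exact: ltnW.
  exact/reduced_tl/reduced_tl/red.
exists j, t; split=> //; rewrite -conj_t !pos_cons mulgA conjgM.
by rewrite def_b def_a rev_ordK conj_sigma_step.
Qed.

Lemma reduced_nseq_twist_free e i t :
  reduced t -> twist_free i t -> reduced (nseq e i ++ t).
Proof.
move=> red_t free_t; elim: e => // e IHe; rewrite [_ ++ _]/= reduced_cons {}IHe /=.
case: e => [|e]; last by case: e => [|e] /=; rewrite ?eqxx //; case: t {red_t free_t}.
case: t free_t {red_t} => [|a [|b t]] //= /andP[a_i /eqP->].
by rewrite a_i orbT.
Qed.

(** The last hypothesis holds whenever [pos r * pos t] is a power of Delta, by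
    [reduced_DeltaX]; it is how duality of [r] and [t] enters. *)
Lemma dual_splice r t i e : (0 < e)%N -> reduced r -> reduced t ->
    twist_free i t -> (reduced (r ++ t) -> r ++ t = [::]) ->
  reduced (r ++ nseq e i ++ t).
Proof.
case: e => // e _ red_r red_t free_t red_rt.
case: t => [|j t] in red_t free_t red_rt *.
  move: red_rt; rewrite cats0 => /(_ red_r) ->.
  exact: reduced_nseq_twist_free.
have {red_rt} not_red : ~~ reduced (r ++ j :: t).
  by apply/negP => /red_rt; case: (r).
have red_bt b : reduced (b :: j :: t).
  rewrite reduced_cons red_t; case: t free_t {red_t not_red} => [|c t] //=.
  by case/andP=> _ /eqP->; rewrite [j == b]eq_sym orbN.
case/lastP: r => [|r b] in red_r not_red *; first by rewrite red_t in not_red.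
case/lastP: r => [|r a] in red_r not_red *; first by rewrite red_bt in not_red.
rewrite -!cats1 -catA in red_r.
rewrite !cat_rcons reduced_glue in not_red *.
(* The forbidden factor must be [a b j], where [a b] ends [r] and [j] begins
   [t]; hence [a = j], and [b] is the other generator, [i]. *)
rewrite red_r reduced_cons red_bt /= negb_or negbK in not_red.
have [/andP[a_b /eqP j_a] /andP[j_i _]] := (not_red, free_t).
have b_i : b = i.
  have /neq_ord2-> : b != a by rewrite eq_sym.
  by rewrite -j_a [j](neq_ord2 j_i) rev_ordK.
rewrite reduced_glue [reduced (r ++ _)]red_r b_i reduced_cons.
rewrite (reduced_nseq_twist_free e.+2 red_t free_t) /=.
by rewrite -j_a [i == j]eq_sym j_i orbT.
Qed.

Theorem theorem3p24 (e : nat) (he : (1 <= e)%N) (g : B3)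
    (hg : half_twist_power e g) :
  exists (rho tau : B3) (i : 'I_2),
    dual rho tau /\
    garside_normal_form g (- omega tau)%R (rho * sigma i ^+ e * tau).
Proof.
case: hg => h [x ->] ->.
have [k [w [red_w ->]]] := garside_form x.
have [f _ fE] := sigma_conj_zexpg_Delta k.
have [i [t [red_t free_t conj_t]]] := twist_free_conj (f ord0) red_w.
rewrite conjgM [sigma1 ^ _]fE conj_t.
have [l [r [red_r def_r]]] := garside_form (pos t)^-1.
(* The exponent [l] cannot be positive, as 1 is not divisible by Delta. *)
have [n def_n] : exists n, pos r * pos t = Delta ^+ n.
  have one_rt : 1 = zexpg Delta l * (pos r * pos t) by rewrite mulgA -def_r mulVg.
  case: l => [[|n]|n] in def_r one_rt *.
  - by exists 0; apply: etrans (esym one_rt); rewrite mul1g.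
  - case: (@reduced_indivisible [::]) => //.
    exists (Delta ^+ n * (pos r * pos t)).
      by apply: positiveM (positive_Delta n) (positiveM _ _); apply: positive_pos.
    by rewrite mulgA -expgS; apply: etrans one_rt; rewrite /pos big_nil.
  - by exists n.+1; rewrite -[LHS](mulVKg (Delta ^+ n.+1)) -one_rt mulg1.
have rt_dual : dual (pos r) (pos t).
  split; try exact: positive_pos; try exact: reduced_indivisible.
  by exists n.
exists (pos r), (pos t), i; split=> //.
have [_ [_ _ def_tV]] := dual_omega rt_dual.
rewrite -pos_nseq -!pos_cat -catA; split; first exact: positive_pos.
  apply/reduced_indivisible/dual_splice => // red_rt.
  by apply: (@reduced_DeltaX _ n red_rt); rewrite pos_cat.
by rewrite !pos_cat pos_nseq -conjXg conjgE def_tV -!mulgA.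
Qed.
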